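(* Let $n\ge 4$, and let $\mathcal{V}=\mathrm{Var}(A_{n+1})$. If $A_n$ is identified with the subgroup of $A_{n+1}$ fixing the point $n+1$, then $\mathrm{dom}_{A_{n+1}}^{\mathcal{V}}(A_n)=A_{n+1}$, so the embedding $A_n\hookrightarrow A_{n+1}$ is a nonsurjective epimorphism in $\mathrm{Var}(A_{n+1})$.
   Context: $A_n$ denotes the alternating group on $\{1,\ldots,n\}$. A variety of groups is a class of groups (regarded as a full subcategory of the category of all groups) closed under taking quotients, subgroups and arbitrary direct products. $\mathrm{Var}(G)$ denotes the variety generated by $G$, i.e. the smallest variety containing $G$. Given a variety $\mathcal{V}$, a group $G\in\mathcal{V}$ and a subgroup $H\le G$, the dominion of $H$ in $G$ in $\mathcal{V}$ is $$\mathrm{dom}_G^{\mathcal{V}}(H)=\{a\in G \mid \text{for all } C\in\mathcal{V} \text{ and all homomorphisms } f,g\colon G\to C,\ \text{if } f|_H=g|_H \text{ then } f(a)=g(a)\}.$$ A homomorphism $f\colon A\to B$ in $\mathcal{V}$ is an epimorphism in $\mathcal{V}$ if for every $C\in\mathcal{V}$ and all homomorphisms $g,h\colon B\to C$, $g\circ f=h\circ f$ implies $g=h$. *)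

(* Defs.v *)
From HB Require Import structures.
From mathcomp Require Import all_boot all_fingroup all_solvable.
From mathcomp Require Import boolp classical_sets.

Set Implicit Arguments.
Unset Strict Implicit.
Unset Printing Implicit Defensive.

Local Open Scope group_scope.

(* The unrestricted direct product; the choice structure that [groupType]
   demands of its carrier comes from boolp, for an arbitrary index type. *)
Definition direct_product (I : Type) (G : I -> groupType) : Type :=
  forall i, G i.

Section DirectProduct.
Variables (I : Type) (G : I -> groupType).
Implicit Types x y z : direct_product G.

Let one : direct_product G := fun i => 1.
Let inv x : direct_product G := fun i => (x i)^-1.
Let mul x y : direct_product G := fun i => x i * y i.

Fact direct_product_mulA : associative mul.
Proof. by move=> x y z; apply: functional_extensionality_dep => i; exact: mulgA. Qed.
Fact direct_product_mul1 : left_id one mul.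
Proof. by move=> x; apply: functional_extensionality_dep => i; exact: mul1g. Qed.
Fact direct_product_mulr1 : right_id one mul.
Proof. by move=> x; apply: functional_extensionality_dep => i; exact: mulg1. Qed.
Fact direct_product_mulV : left_inverse one inv mul.
Proof. by move=> x; apply: functional_extensionality_dep => i; exact: mulVg. Qed.
Fact direct_product_mulrV : right_inverse one inv mul.
Proof. by move=> x; apply: functional_extensionality_dep => i; exact: mulgV. Qed.

HB.instance Definition _ := Choice.copy (direct_product G) (forall i, G i).
HB.instance Definition _ := isGroup.Build (direct_product G)
  direct_product_mulA direct_product_mul1 direct_product_mulr1
  direct_product_mulV direct_product_mulrV.

End DirectProduct.

(* [groupType] is the type of all groups, finite or not. Classes of groups are
   closed under isomorphism: up to isomorphism, a quotient of G is the target
   of a surjective homomorphism from G, and a subgroup of G is the source of an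
   injective homomorphism to G. *)
Record variety (V : groupType -> Prop) : Prop := Variety {
  variety_quotient : forall (G Q : groupType) (f : {multiplicative G -> Q}),
    (forall y, exists x, f x = y) -> V G -> V Q;
  variety_subgroup : forall (G H : groupType) (f : {multiplicative H -> G}),
    injective f -> V G -> V H;
  variety_product : forall (I : Type) (G : I -> groupType),
    (forall i, V (G i)) -> V (direct_product G)
}.

Definition Var (G : groupType) : groupType -> Prop :=
  fun K => forall V : groupType -> Prop, variety V -> V G -> V K.

Lemma Var_variety (G : groupType) : variety (Var G).
Proof.
split=> [K Q f f_surj VK V vV VG | K H f f_inj VK V vV VG | I K VK V vV VG].
- exact: (variety_quotient vV f_surj (VK V vV VG)).
- exact: (variety_subgroup vV f_inj (VK V vV VG)).
- by apply: (variety_product vV) => i; exact: VK.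
Qed.

Lemma Var_self (G : groupType) : Var G G.
Proof. by []. Qed.

Definition dominion (V : groupType -> Prop) (G : groupType) (H : set G) :
    set G :=
  [set a | forall (C : groupType) (f g : {multiplicative G -> C}), V C ->
    (forall x, H x -> f x = g x) -> f a = g a]%classic.

Definition epimorphism (V : groupType -> Prop) (A B : groupType)
    (f : {multiplicative A -> B}) : Prop :=
  [/\ V A, V B &
    forall (C : groupType) (g h : {multiplicative B -> C}), V C ->
      g \o f =1 h \o f -> g =1 h].

(* The points 1, ..., n of the text are the elements 0, ..., n-1 of 'I_n, so
   that the point n+1 is [ord_max : 'I_n.+1]. *)
Notation AltG n := [subg 'Alt_('I_n)]%type.

Definition alt_fix_last (n : nat) : set (AltG n.+1) :=
  [set s | (sgval s : 'S_n.+1) ord_max = ord_max]%classic.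
Arguments alt_fix_last n : clear implicits.

Section AltEmbed.
Variable n : nat.

Fact alt_embed_subproof (s : AltG n) :
  lift_perm ord_max ord_max (sgval s) \in 'Alt_('I_n.+1).
Proof. by rewrite Alt_even odd_lift_perm addbb /= -Alt_even; exact: subgP. Qed.

(* Extend s by making it fix the new point. *)
Definition alt_embed (s : AltG n) : AltG n.+1 := Subg (alt_embed_subproof s).

Fact alt_embedM : {morph alt_embed : s t / s * t}.
Proof. by move=> s t; apply: val_inj; rewrite /= lift_permM. Qed.

HB.instance Definition _ :=
  isMultiplicative.Build (AltG n) (AltG n.+1) alt_embed alt_embedM.

Lemma alt_embed_inj : injective alt_embed.
Proof.
move=> s t /(congr1 sgval) /= eq_st; apply: val_inj; apply/permP => i /=.
by apply: (@lift_inj _ ord_max); rewrite -!(lift_perm_lift ord_max) eq_st.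
Qed.

Lemma range_alt_embed : range alt_embed = alt_fix_last n.
Proof.
apply/seteqP; split=> [_ [s _ <-] | s fix_s]; first exact: lift_perm_id.
have ne (i : 'I_n) : ord_max != (sgval s : 'S_n.+1) (lift ord_max i).
  rewrite -[X in X != _]fix_s (inj_eq perm_inj).
  exact: neq_lift.
pose u i := odflt i (unlift ord_max ((sgval s : 'S_n.+1) (lift ord_max i))).
have uE i : lift ord_max (u i) = (sgval s : 'S_n.+1) (lift ord_max i).
  by rewrite /u; case: unliftP (ne i) => [j -> | ->] //=; rewrite eqxx.
have u_inj : injective u.
  move=> i j /(congr1 (lift ord_max)); rewrite !uE.
  by move/perm_inj/lift_inj.
have sE : lift_perm ord_max ord_max (perm u_inj) = sgval s.
  apply/permP=> i; case: (unliftP ord_max i) => [j -> | ->].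
    by rewrite lift_perm_lift permE uE.
  by rewrite lift_perm_id fix_s.
have u_alt : perm u_inj \in 'Alt_('I_n).
  rewrite Alt_even; have := subgP s.
  by rewrite Alt_even -sE odd_lift_perm addbb.
by exists (Subg u_alt) => //; apply: val_inj.
Qed.

End AltEmbed.
Arguments alt_embed n s : clear implicits.

(* Main.v *)
(* Every group of Var G satisfies the laws of G := A_(n+1). Let f, g : G -> C
   agree on H := A_n, with C satisfying these laws. Words in two disjoint copies
   of G are evaluated in C by d := (f, g), and in G by [snd], which folds the two
   copies together; let K be the image under d of the words folding to 1, and Z
   the centralizer of K.
   - Nontrivial normal subgroups of a nonabelian simple group do not commute, so
     a homomorphism onto G from a subgroup of a finite power of G is, up to an
     automorphism, a coordinate projection.
   - Hence, if f(G) or g(G) met Z trivially, there would be a map phi from the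
     words to G, trivial on those evaluated in Z and bijective on one copy of G.
     Endomorphisms of G agreeing on H, one of which is injective, are equal, so
     phi would be the folding map up to an automorphism.
   - However, some word with value in Z does not fold to 1: take one killed by
     all the evaluations in G that do not vanish on the words folding to 1.
   So f(G) and g(G) meet Z, hence lie in Z by simplicity. Then f(x) g(x)^-1, an
   element of K, is a homomorphism in x that is trivial on H, thus trivial. *)
Require Import Defs.
From HB Require Import structures.
From mathcomp Require Import all_boot all_fingroup all_solvable.
From mathcomp Require Import boolp classical_sets.

Set Implicit Arguments.
Unset Strict Implicit.
Unset Printing Implicit Defensive.

Local Open Scope group_scope.

(** * Group words, their values and the laws of a group *)

Lemma morphM1 (A B : groupType) (f : A -> B) : {morph f : x y / x * y} -> f 1 = 1.
Proof. by move=> fM; apply: (mulgI (f 1)); rewrite -fM !mulg1. Qed.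

Lemma morphMV (A B : groupType) (f : A -> B) :
  {morph f : x y / x * y} -> {morph f : x / x^-1}.
Proof.
move=> fM x; apply: (mulgI (f x)); rewrite -fM !mulgV; exact: morphM1.
Qed.

Inductive word (X : Type) : Type :=
  | wvar of X
  | wmul of word X & word X
  | winv of word X.

Fixpoint eval (X : Type) (A : groupType) (d : X -> A) (w : word X) : A :=
  match w with
  | wvar x => d x
  | wmul w1 w2 => eval d w1 * eval d w2
  | winv w1 => (eval d w1)^-1
  end.

Definition wcomm X (w1 w2 : word X) : word X :=
  wmul (winv w1) (wmul (winv w2) (wmul w1 w2)).

Lemma eval_wcomm X (A : groupType) (d : X -> A) w1 w2 :
  eval d (wcomm w1 w2) = [~ eval d w1, eval d w2].
Proof. by rewrite /= /commg /conjg. Qed.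

Lemma eval_comp X (A B : groupType) (f : A -> B) (d : X -> A) w :
  {morph f : x y / x * y} -> eval (f \o d) w = f (eval d w).
Proof.
move=> fM; elim: w => [x | w1 IH1 w2 IH2 | w IH] //=.
  by rewrite IH1 IH2 fM.
by rewrite IH (morphMV fM).
Qed.

Definition satisfies_laws (G C : groupType) : Prop :=
  forall (X : Type) (w : word X), (forall d : X -> G, eval d w = 1) ->
  forall d : X -> C, eval d w = 1.

(** Assignments lift along a surjection, can be compared after an injection, and split into
    coordinates in a product. *)
Lemma satisfies_laws_variety (G : groupType) : variety (satisfies_laws G).
Proof.
split=> [A Q f f_surj lawA | A B f f_inj lawA | I A lawA] X w lawG d.
- have [d' d'K] := choice (fun x => f_surj (d x)).
  have -> : d = f \o d' by apply/funext => x /=; rewrite d'K.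
  by rewrite eval_comp ?lawA //; [apply: morphM1 | ]; exact: gmulfM.
- apply: f_inj; rewrite -eval_comp ?lawA //; last exact: gmulfM.
  by rewrite morphM1 //; exact: gmulfM.
- apply: functional_extensionality_dep => i.
  by rewrite -(@eval_comp _ (Defs.direct_product A) (A i) (fun y => y i)) ?lawA.
Qed.

(** The easy half of Birkhoff's theorem. *)
Lemma Var_satisfies_laws (G C : groupType) : Var G C -> satisfies_laws G C.
Proof. by apply => //; exact: satisfies_laws_variety. Qed.

(* [u] plays the part of a surjective homomorphism to [A] defined on a subgroup
   [T] of a free group; words are not identified up to group equations. *)
Record word_surjection X (A : groupType) (T : word X -> Prop) (u : word X -> A) :
    Prop := WordSurjection {
  wsurj_domM : forall v w, T v -> T w -> T (wmul v w);
  wsurj_domV : forall w, T w -> T (winv w);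
  wsurjM : forall v w, T v -> T w -> u (wmul v w) = u v * u w;
  wsurjV : forall w, T w -> u (winv w) = (u w)^-1;
  wsurj_onto : forall x, exists2 w, T w & u w = x
}.

(** * Words over a finite nonabelian simple group *)

Section SimpleGroup.

Variable G : finGroupType.
Hypotheses (simpleG : simple [set: G]) (nabG : ~~ abelian [set: G]).

(** In a finite group, a subset containing 1 and closed under products is already a subgroup. *)
Lemma simple_normal_full (P : G -> Prop) :
  P 1 -> (forall x y, P x -> P y -> P (x * y)) ->
  (forall x y, P x -> P (x ^ y)) ->
  (exists2 x, P x & x <> 1) -> forall x, P x.
Proof.
move=> P1 PM PJ [x0 Px0 x0_n1] x.
have gP : group_set [set y | `[< P y >]].
  apply/group_setP; split=> [|y z]; rewrite !inE //; exact: PM.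
have nP : group gP <| [set: G].
  rewrite /normal finset.subsetT; apply/fintype.subsetP => y _; rewrite inE.
  apply/fintype.subsetP => _ /imsetP [z zP ->]; move: zP.
  by rewrite !inE; exact: PJ.
have memP y : (y \in group gP) = `[< P y >] by rewrite !inE.
have [_ /(_ _ nP) [E|E]] := simpleP _ simpleG.
  by have /asboolP := Px0; rewrite -memP E inE => /eqP.
by apply/asboolP; rewrite -memP E inE.
Qed.

Lemma simple_morph_trivial (C : groupType) (f : G -> C) :
  {morph f : x y / x * y} -> (exists2 x, f x = 1 & x <> 1) ->
  forall x, f x = 1.
Proof.
move=> fM; apply: simple_normal_full; first exact: morphM1.
- by move=> x y fx fy; rewrite fM fx fy mulg1.
- by move=> x y fx; rewrite conjgE !fM fx mul1g -fM mulVg morphM1.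
Qed.

Lemma simple_noncentral (a : G) : a <> 1 -> exists b, ~ commute a b.
Proof.
move=> a_n1; apply: contrapT => /forallNP cen.
have ca b : commute a b by apply: contrapT; exact: cen.
move/negP: nabG; apply; apply/centsP => x _ y _.
apply: (@simple_normal_full (fun x => forall z, commute x z)).
- by move=> z; exact/commute_sym/commute1.
- by move=> {x y}x y cx cy z; exact/commute_sym/commuteM/commute_sym/cy/commute_sym.
- move=> {x y}x y cx z; suff -> : x ^ y = x by [].
  by apply/conjg_fixP/commgP.
- by exists a.
Qed.

(** The elements whose conjugates all commute with [a] form a normal subgroup; if it contained [b],
    it would be everything and [a] would be central. *)
Lemma simple_noncommuting_conj (a b : G) :
  a <> 1 -> b <> 1 -> exists c, ~ commute a (b ^ c).
Proof.
move=> /simple_noncentral [y ncay] b_n1; apply: contrapT => /forallNP com.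
apply: ncay; move: (y).
have caJ c : commute a (b ^ c) by apply: contrapT; exact: com.
move=> z; suff /(_ 1) : forall c, commute a (z ^ c) by rewrite conjg1.
apply: (@simple_normal_full (fun z => forall c, commute a (z ^ c))).
- by move=> c; rewrite conj1g; exact: commute1.
- by move=> x1 y1 cx cy c; rewrite conjMg; apply: commuteM.
- by move=> x1 y1 cx c; rewrite -conjgM.
- by exists b.
Qed.

(** Induction on [s]: take the commutator of a word killed along the tail with a conjugate of one
    killed at the head, the conjugate being chosen so that the images under [u] do not commute. *)
Lemma word_common_kernel X (T : word X -> Prop) (u : word X -> G)
    (I : eqType) (phi : I -> X -> G) (s : seq I) :
  word_surjection T u ->
  (forall i, i \in s -> exists w, [/\ T w, eval (phi i) w = 1 & u w <> 1]) ->
  exists w, [/\ T w, forall i, i \in s -> eval (phi i) w = 1 & u w <> 1].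
Proof.
move=> Tu; elim: s => [_ | i s IH kers].
  have [a a_n1] : exists a : G, a <> 1.
    have [/trivgPn [a _ /eqP a_n1] _] := simpleP _ simpleG.
    by exists a.
  by have [w Tw uw] := wsurj_onto Tu a; exists w; split; rewrite ?uw.
have [j js|w1 [Tw1 kw1 uw1]] := IH; first by apply: kers; rewrite inE js orbT.
have [w2 [Tw2 kw2 uw2]] := kers i (mem_head i s).
have [c ncomm] := simple_noncommuting_conj uw1 uw2.
have [v Tv uv] := wsurj_onto Tu c.
pose w3 := wmul (winv v) (wmul w2 v).
have Tw3 : T w3.
  by do ?[apply: (wsurj_domM Tu) | apply: (wsurj_domV Tu)].
have uw3 : u w3 = u w2 ^ c.
  by rewrite /w3 !(wsurjM Tu, wsurjV Tu) ?uv //;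
     do ?[apply: (wsurj_domM Tu) | apply: (wsurj_domV Tu)].
exists (wcomm w1 w3); split.
- by do ?[apply: (wsurj_domM Tu) | apply: (wsurj_domV Tu)].
- move=> j; rewrite eval_wcomm inE => /predU1P [->|js].
    by rewrite /= kw2 mul1g mulVg commg1.
  by rewrite kw1 // comm1g.
- move=> uc; apply/ncomm/commgP/eqP; rewrite -uw3 -uc /commg /conjg.
  by rewrite /wcomm !(wsurjM Tu, wsurjV Tu) //;
     do ?[apply: (wsurj_domM Tu) | apply: (wsurj_domV Tu)].
Qed.

(* The image of [T] under [phi] is a subgroup of G mapping onto G, hence is G. *)
Lemma word_kernel_eq X (T : word X -> Prop) (u : word X -> G) (phi : X -> G) :
  word_surjection T u ->
  (forall w, T w -> eval phi w = 1 -> u w = 1) ->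
  forall w, T w -> u w = 1 -> eval phi w = 1.
Proof.
move=> Tu ker_sub w Tw uw.
have eval_u v1 v2 : T v1 -> T v2 -> eval phi v1 = eval phi v2 -> u v1 = u v2.
  move=> Tv1 Tv2 e; apply: (mulIg (u v2)^-1); rewrite mulgV -(wsurjV Tu) //.
  rewrite -(wsurjM Tu) //; last exact: (wsurj_domV Tu).
  apply: ker_sub; last by rewrite /= e mulgV.
  by apply: (wsurj_domM Tu) => //; exact: (wsurj_domV Tu).
have onto x : exists v, T v /\ u v = x.
  by have [v] := wsurj_onto Tu x; exists v.
have [r rP] := choice onto.
(* [h x] is the value of a word that [u] sends to [x]; injective on a finite type, [h] is onto. *)
pose h x := eval phi (r x).
have h_inj : injective h.
  by move=> x y /eval_u; rewrite !(proj2 (rP _)); apply; exact: (proj1 (rP _)).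
have h1 : h 1 = 1.
  have e1 : h (invF h_inj 1) = 1 by rewrite f_invF.
  have := ker_sub _ (proj1 (rP _)) e1.
  by rewrite (proj2 (rP _)) => E; rewrite E in e1.
have e : h (invF h_inj (eval phi w)) = eval phi w by rewrite f_invF.
have := eval_u _ _ (proj1 (rP _)) Tw e.
by rewrite (proj2 (rP _)) uw => E; rewrite -e E.
Qed.

(** There are finitely many assignments. If each killed some word of [T] that [u] does not, a single
    such word would be killed by all of them, against the hypothesis on laws. *)
Lemma exists_word_kernel_eq (X : finType) (T : word X -> Prop) (u : word X -> G) :
  word_surjection T u ->
  (forall w, T w -> (forall phi : X -> G, eval phi w = 1) -> u w = 1) ->
  exists phi : X -> G, forall w, T w -> (eval phi w = 1 <-> u w = 1).
Proof.
move=> Tu law_u; suff [phi phiP] : exists phi : X -> G,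
    forall w, T w -> eval phi w = 1 -> u w = 1.
  exists phi => w Tw; split; first exact: phiP.
  exact: (word_kernel_eq Tu phiP Tw).
apply: contrapT => /forallNP noker.
have [|w [Tw kw]] := @word_common_kernel X T u {ffun X -> G}
    (fun i : {ffun X -> G} => i : X -> G) (enum [set: {ffun X -> G}]) Tu.
  move=> i _; apply: contrapT => noti; apply: (noker i) => w Tw iw.
  by apply: contrapT => uw; apply: noti; exists w.
apply; apply: law_u => // phi.
have -> : phi = finfun phi by apply/funext => x; rewrite ffunE.
by apply: kw; rewrite mem_enum inE.
Qed.

(** * Two homomorphisms out of G that agree on H *)

Section Amalgam.

Variables (C : groupType) (H : G -> Prop) (h : bool -> G -> C).
Hypothesis lawC : satisfies_laws G C.
Hypothesis hM : forall b, {morph h b : x y / x * y}.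
Hypothesis h_agree : forall b c x, H x -> h b x = h c x.
Hypothesis rigidH : forall alpha beta : G -> G,
  {morph alpha : x y / x * y} -> {morph beta : x y / x * y} ->
  injective alpha -> (forall x, H x -> alpha x = beta x) -> alpha =1 beta.

Let d (p : bool * G) : C := h p.1 p.2.

(** [Z] and the image of [h b] form a semidirect product. On words with value in it, the projection
    onto G has the same kernel as some evaluation [phi] in G, which rigidity forces to be the
    folding map followed by an injective endomorphism. *)
Lemma eval_fold_eq1 (b : bool) (Z : C -> Prop) :
  Z 1 -> (forall y z, Z y -> Z z -> Z (y * z)) -> (forall z, Z z -> Z z^-1) ->
  (forall z x, Z z -> Z (z ^ h b x)) -> (forall x, Z (h b x) -> x = 1) ->
  forall w, Z (eval d w) -> eval snd w = 1.
Proof.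
move=> Z1 ZM ZV ZJ hZ1.
have h1 c : h c 1 = 1 := morphM1 (hM c).
have hV c : {morph h c : x / x^-1} := morphMV (hM c).
(* [U x y] puts [y] in the coset of [h b x] modulo [Z]; [v] recovers [x], with the arbitrary value 1
   outside the product. *)
pose U x y := Z ((h b x)^-1 * y).
have [v vP] : exists v : C -> G, forall y x, U x y -> v y = x.
  have ex y : exists x, forall x', U x' y -> x = x'.
    have [[x Uxy]|] := pselect (exists x, U x y); last first.
      by move=> /forallNP nU; exists 1 => x' /nU.
    exists x => x' Ux'y; apply: (mulgI x^-1); rewrite mulVg; apply/esym.
    apply: hZ1; rewrite hM hV.
    suff -> : (h b x)^-1 * h b x' = (h b x)^-1 * y * ((h b x')^-1 * y)^-1.
      by apply: ZM => //; apply: ZV.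
    by rewrite invMg invgK mulgA mulgK.
  by have [v vP] := choice ex; exists v => y x; exact: vP.
have UM x1 x2 y1 y2 : U x1 y1 -> U x2 y2 -> U (x1 * x2) (y1 * y2).
  rewrite /U => U1 U2.
  suff -> : (h b (x1 * x2))^-1 * (y1 * y2) =
      ((h b x1)^-1 * y1) ^ h b x2 * ((h b x2)^-1 * y2).
    by apply: ZM => //; exact: ZJ.
  by rewrite hM conjgE invMg !mulgA mulgK.
have UV x y : U x y -> U x^-1 y^-1.
  rewrite /U hV invgK => Uxy.
  suff -> : h b x * y^-1 = ((h b x)^-1 * y)^-1 ^ h b x^-1.
    by apply/ZJ/ZV.
  by rewrite hV conjgE invMg !invgK mulgK.
have Uh x : U x (h b x) by rewrite /U mulVg.
pose T w := exists x, U x (eval d w).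
have Tv : word_surjection T (fun w => v (eval d w)).
  split=> [w1 w2 [x1 U1] [x2 U2]|w [x Uw]|w1 w2 [x1 U1] [x2 U2]|w [x Uw]|x].
  - by exists (x1 * x2); exact: UM.
  - by exists x^-1; exact: UV.
  - by rewrite (vP _ _ U1) (vP _ _ U2) /=; apply/vP/UM.
  - by rewrite (vP _ _ Uw) /=; apply/vP/UV.
  - by exists (wvar (b, x)); [exists x | apply: vP]; exact: Uh.
have U1Z z : Z z -> U 1 z by rewrite /U h1 invg1 mul1g.
have [w Tw /lawC lw|phi phiP] := exists_word_kernel_eq Tv.
  by rewrite lw; apply/vP/U1Z.
have phiZ w : Z (eval d w) -> eval phi w = 1.
  by move=> /U1Z Zw; apply/phiP; [exists 1 | exact: vP].
(* Multiplicativity of [al c], and its agreement with [al b] on [H], are expressed by words with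
   value 1 under [d], which [phi] kills. *)
pose al c x := phi (c, x).
have alM c : {morph al c : x y / x * y}.
  move=> x y; pose w := wmul (wvar (c, x * y))
                             (winv (wmul (wvar (c, x)) (wvar (c, y)))).
  apply: (mulIg (al c x * al c y)^-1).
  by rewrite mulgV; apply: (phiZ w); rewrite /= /d /= hM mulgV.
have al_inj : injective (al b).
  move=> x y e; apply: (mulIg y^-1); rewrite mulgV.
  have Txy : T (wvar (b, x * y^-1)) by exists (x * y^-1); exact: Uh.
  rewrite -(vP _ _ (Uh (x * y^-1))); apply: (phiP _ Txy).1.
  by rewrite /= -/(al b _) alM e -alM mulgV (morphM1 (alM b)).
have alH c x : H x -> al b x = al c x.
  move=> Hx; pose w := wmul (wvar (b, x)) (winv (wvar (c, x))).
  apply: (mulIg (al c x)^-1); rewrite mulgV; apply: (phiZ w).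
  by rewrite /= /d /= (h_agree b c Hx) mulgV.
have phiE : phi = al b \o snd.
  apply/funext => -[c x] /=; apply/esym.
  by apply: (rigidH (alM b) (alM c)) => // y; exact: alH.
move=> w /phiZ; rewrite phiE eval_comp // => e; apply: al_inj.
by rewrite e (morphM1 (alM b)).
Qed.

Let Z (z : C) := forall w, eval snd w = 1 -> commute z (eval d w).

Lemma exists_centralizing_word : exists2 w, Z (eval d w) & eval snd w <> 1.
Proof.
have Tu : @word_surjection (bool * G) G (fun _ => True) (eval snd).
  by split=> // x; exists (wvar (true, x)).
pose I := {ffun bool * G -> G}.
(* By [word_kernel_eq], an assignment outside [bad] kills every word folding to 1, while those in
   [bad] kill [w0]. Commutators of [w0] with words folding to 1 are therefore laws of G, valid in
   [C]. *)
pose bad := [set i : I | `[< exists2 w, eval i w = 1 & eval snd w <> 1 >]].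
have [i|w0 [_ k0 e0]] := @word_common_kernel _ _ _ I (fun i => i) (enum bad) Tu.
  by rewrite mem_enum inE => /asboolP [w iw sw]; exists w.
exists w0 => // w sw; apply/commgP/eqP; rewrite -eval_wcomm.
apply: lawC => phi; rewrite eval_wcomm.
pose i : I := finfun phi.
have -> : phi = i by apply/funext => x; rewrite ffunE.
have [/asboolP ibad|good] := pselect (exists2 w, eval i w = 1 & eval snd w <> 1).
  by rewrite k0 ?comm1g // mem_enum inE.
suff -> : eval i w = 1 by rewrite commg1.
apply: (word_kernel_eq Tu) => // v _ iv; apply: contrapT => sv.
by apply: good; exists v.
Qed.

Lemma amalgam_central b x : Z (h b x).
Proof.
have Z1 : Z 1 by move=> w _; exact/commute_sym/commute1.
have ZM y z : Z y -> Z z -> Z (y * z).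
  move=> Zy Zz w sw; apply/commute_sym/commuteM; apply/commute_sym.
    exact: Zy.
  exact: Zz.
have ZV z : Z z -> Z z^-1.
  by move=> Zz w sw; apply/commute_sym/commuteV/commute_sym/Zz.
have ZJ c y z : Z z -> Z (z ^ h c y).
  move=> Zz w sw.
  (* The conjugation is moved onto [w]: the conjugate word [w'] still folds to 1. *)
  pose w' := wmul (wvar (c, y)) (wmul w (wvar (c, y^-1))).
  have -> : eval d w = eval d w' ^ h c y.
    by rewrite /= /d /= (morphMV (hM c)) conjgE !mulgA mulVg mul1g mulgKV.
  rewrite /commute -!conjMg; congr (_ ^ _); apply: Zz.
  by rewrite /= sw mul1g mulgV.
move: x; apply: (@simple_normal_full (fun x => Z (h b x))).
- by rewrite (morphM1 (hM b)).
- by move=> x y; rewrite hM; exact: ZM.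
- move=> x y Zx; rewrite conjgE !hM (morphMV (hM b)) -conjgE; exact: ZJ.
- apply: contrapT => noZ; have [w0 Zw0] := exists_centralizing_word; apply.
  apply: (@eval_fold_eq1 b Z) => // [z x|x Zx]; first exact: ZJ.
  by apply: contrapT => x_n1; apply: noZ; exists x.
Qed.

End Amalgam.

(** Reduces the dominion to a rigidity property of endomorphisms of G, with no reference to [C]. *)
Lemma simple_law_extension (C : groupType) (H : G -> Prop) (f g : G -> C) :
  satisfies_laws G C ->
  {morph f : x y / x * y} -> {morph g : x y / x * y} ->
  (exists2 x, H x & x <> 1) -> (forall x, H x -> f x = g x) ->
  (forall alpha beta : G -> G,
    {morph alpha : x y / x * y} -> {morph beta : x y / x * y} ->
    injective alpha -> (forall x, H x -> alpha x = beta x) -> alpha =1 beta) ->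
  f =1 g.
Proof.
move=> lawC fM gM [x0 Hx0 x0_n1] fgH rigidH.
pose h b := if b then f else g.
have cent : forall b x w, eval snd w = 1 ->
    commute (h b x) (eval (fun p => h p.1 p.2) w).
  apply: (@amalgam_central C H h) => //.
  - by move=> b; case: b.
  - by move=> b c x Hx; case: b c => [] [] //=; rewrite fgH.
pose k x := f x * (g x)^-1.
have ck b x y : commute (h b x) (k y).
  have := @cent b x (wmul (wvar (true, y)) (winv (wvar (false, y)))).
  by apply; rewrite /= mulgV.
have kM : {morph k : x y / x * y}.
  move=> x y; rewrite /k fM gM invMg.
  (* [k (x * y)] is [f x * k y * (g x)^-1], and [k y] moves past the last factor. *)
  have c : commute (k y) (g x)^-1 := commuteV (commute_sym (ck false x y)).
  by rewrite -mulgA -[RHS]mulgA; congr (_ * _); rewrite -c mulgA.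
move=> x; apply: (mulIg (g x)^-1); rewrite mulgV.
apply: (simple_morph_trivial kM); exists x0 => //.
by rewrite /k fgH // mulgV.
Qed.

End SimpleGroup.

(** * Alternating groups of degree at least five *)

Lemma exists_notin_seq (T : finType) (s : seq T) :
  size s < #|T| -> exists x, x \notin s.
Proof.
move=> sT; apply/existsP; apply: contraTT sT => /existsPn ns; rewrite -leqNgt.
apply: leq_trans (card_size s).
by apply/subset_leq_card/fintype.subsetP => x _; have := ns x; rewrite negbK.
Qed.

(** A 3-cycle on [a], [b] and a point [c] off [e] and [f]; five points leave room for it. The points
    [e] and [f] may coincide. *)
Lemma exists_even_perm_fix2 (T : finType) (a b e f : T) :
  4 < #|T| -> [&& a != b, a != e, b != e, a != f & b != f] ->
  exists s : {perm T}, [/\ s \in 'Alt_T, s a = b, s e = e & s f = f].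
Proof.
move=> T5 /and5P[ab ae be af bf].
have [c] := exists_notin_seq (T5 : size [:: a; b; e; f] < _).
rewrite !inE !negb_or => /and4P[ca cb ce cf].
exists (tperm a b * tperm a c); split.
- by rewrite Alt_even odd_permM !odd_tperm ab eq_sym ca.
- by rewrite permM tpermL tpermD // eq_sym.
- by rewrite permM !tpermD.
- by rewrite permM !tpermD.
Qed.

Section Alternating.

Variable n : nat.
Hypothesis n_ge4 : 4 <= n.

Let T5 : 4 < #|'I_n.+1|. Proof. by rewrite card_ord. Qed.

Let pt (x : AltG n.+1) : 'S_n.+1 := sgval x.

Let ptM x y i : pt (x * y) i = pt y (pt x i).
Proof. by rewrite /pt /= permM. Qed.

Let exists_alt_fix2 (a b e f : 'I_n.+1) :
  [&& a != b, a != e, b != e, a != f & b != f] ->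
  exists x : AltG n.+1, [/\ pt x a = b, pt x e = e & pt x f = f].
Proof.
move=> abef.
have [s [sA sa se sf]] := exists_even_perm_fix2 T5 abef.
by exists (Subg sA).
Qed.

Let exists_notin (s : seq 'I_n.+1) : size s < 4 -> exists i, i \notin s.
Proof. by move=> s4; apply/exists_notin_seq/(ltn_trans s4 T5). Qed.

Lemma alt_simple : simple [set: AltG n.+1].
Proof. by rewrite -(isog_simple (isog_subg _)) simple_Alt5. Qed.

Lemma alt_nonabelian : ~~ abelian [set: AltG n.+1].
Proof.
pose m : 'I_n.+1 := ord_max.
have [a] := exists_notin (isT : size [:: m] < 4).
have [b] := exists_notin (isT : size [:: m; a] < 4).
rewrite !inE !negb_or => /andP[bm ba] am.
have [|x [xa _ _]] := @exists_alt_fix2 a b m m.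
  by rewrite eq_sym ba am bm.
have [|y [yb ya _]] := @exists_alt_fix2 b m a a.
  by rewrite bm ba eq_sym am.
apply/negP => /centsP /(_ x _ y _); rewrite !inE => /(_ isT isT).
move/(congr1 (fun z => pt z a)); rewrite !ptM xa yb ya xa => mb.
by rewrite mb eqxx in bm.
Qed.

(** Distinct points other than the last are told apart by their stabilizers in the subgroup; [h]
    moves [q] to a fourth point. *)
Lemma alt_separates_points (p q : 'I_n.+1) :
  p != ord_max -> q != ord_max -> p != q ->
  exists h, [/\ alt_fix_last n h, pt h p = p & pt h q != q].
Proof.
move=> pm qm pq.
have [a] := exists_notin (isT : size [:: ord_max; p; q] < 4).
rewrite !inE !negb_or => /and3P[am ap aq].
have [|h [hq hp hm]] := @exists_alt_fix2 q a p ord_max.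
  by rewrite ap am qm eq_sym aq eq_sym pq.
by exists h; split; rewrite ?hq.
Qed.

Lemma alt_fix_last_nontrivial : exists2 h, alt_fix_last n h & h <> 1.
Proof.
have [p] := exists_notin (isT : size [:: ord_max : 'I_n.+1] < 4).
have [q] := exists_notin (isT : size [:: ord_max; p] < 4).
rewrite !inE !negb_or => /andP[qm qp] pm.
have [|h [hm _ hq]] := alt_separates_points pm qm; first by rewrite eq_sym.
by exists h => // h1; move: hq; rewrite h1 /pt /= perm1 eqxx.
Qed.

Lemma alt_moves_last : exists x, ~ alt_fix_last n x.
Proof.
have [p] := exists_notin (isT : size [:: ord_max : 'I_n.+1] < 4).
have [q] := exists_notin (isT : size [:: ord_max; p] < 4).
rewrite !inE !negb_or => /andP[qm qp] pm.
have [|x [xm _ _]] := @exists_alt_fix2 ord_max p q q.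
  by rewrite ![ord_max == _]eq_sym ![p == q]eq_sym pm qm qp.
exists x => /=; rewrite /alt_fix_last /= -/(pt x) xm => e.
by rewrite e eqxx in pm.
Qed.

Lemma alt_transitive (p : 'I_n.+1) : exists x, pt x ord_max = p.
Proof.
have [->|pm] := eqVneq p ord_max; first by exists 1; rewrite /pt /= perm1.
have [q] := exists_notin (isT : size [:: ord_max; p] < 4).
rewrite !inE negb_or => /andP[qm qp].
have [|x [xm _ _]] := @exists_alt_fix2 ord_max p q q; last by exists x.
  by rewrite ![ord_max == _]eq_sym ![p == q]eq_sym pm qm qp.
Qed.

(* If x and th x moved the last point to p and q != p, there would be h fixing p
   and the last point but moving q. Then x h x^-1 fixes the last point, so it is
   fixed by th, and equals th x h (th x)^-1; hence h fixes q after all. *)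
Lemma alt_rigid_endo (th : AltG n.+1 -> AltG n.+1) :
  {morph th : x y / x * y} -> injective th ->
  (forall x, alt_fix_last n x -> th x = x) -> th =1 id.
Proof.
move=> thM th_inj thH.
have thlast x : pt (th x) ord_max = pt x ord_max.
  have [xm|xm] := eqVneq (pt x ord_max) ord_max; first by rewrite thH.
  have [tm|tm] := eqVneq (pt (th x) ord_max) ord_max.
    (* Here [th x] is itself fixed by [th], so injectivity gives [th x = x]. *)
    have /th_inj e : th (th x) = th x by rewrite thH.
    by rewrite e.
  have [//|xt] := eqVneq (pt (th x) ord_max) (pt x ord_max).
  rewrite eq_sym in xt.
  have [h [hm hx ht]] := alt_separates_points xm tm xt.
  have ptK (y z : AltG n.+1) i : y * z = 1 -> pt z (pt y i) = i.
    by move=> yz; rewrite -ptM yz /pt /= perm1.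
  have fixJ : pt (x * h * x^-1) ord_max = ord_max.
    by rewrite !ptM hx ptK ?mulgV.
  have := thH _ fixJ; rewrite !thM (thH h hm) (morphMV thM) => e.
  move: fixJ; rewrite -e !ptM => /(congr1 (pt (th x))).
  by rewrite ptK ?mulVg // => /eqP; rewrite (negPf ht).
move=> x; apply: val_inj; apply/permP => p; rewrite -/(pt _) -/(pt x).
(* Since [y] and [th y] agree at the last point, the two sides are its images under [th (y * x)] and
   [y * x]. *)
have [y <-] := alt_transitive p.
by rewrite -[in LHS](thlast y) -ptM -thM thlast ptM.
Qed.

(** By simplicity [beta] is injective or trivial, and the latter would make [alpha] trivial on a
    nontrivial subgroup. Then [alpha] is invertible by finiteness, and its inverse after [beta] is
    an injective endomorphism fixing the subgroup pointwise. *)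
Lemma alt_fix_last_rigid (alpha beta : AltG n.+1 -> AltG n.+1) :
  {morph alpha : x y / x * y} -> {morph beta : x y / x * y} ->
  injective alpha -> (forall x, alt_fix_last n x -> alpha x = beta x) ->
  alpha =1 beta.
Proof.
move=> aM bM a_inj abH.
have b_inj : injective beta.
  move=> x y e; apply: (mulIg y^-1); rewrite mulgV; apply: contrapT => xy.
  have [h hH h1] := alt_fix_last_nontrivial.
  apply: h1; apply: a_inj; rewrite abH // (morphM1 aM).
  apply: (simple_morph_trivial alt_simple bM); exists (x * y^-1) => //.
  by rewrite bM e -bM mulgV (morphM1 bM).
move=> x; rewrite -{1}[x](@alt_rigid_endo (invF a_inj \o beta)) /= ?f_invF //.
- by move=> y z; apply: (a_inj _ _); rewrite /= aM !f_invF bM.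
- by apply: inj_comp => //; apply: can_inj; apply: f_invF.
- by move=> y yH /=; rewrite -abH // invF_f.
Qed.

End Alternating.

Theorem theorem3p13 (n : nat) (hn : (4 <= n)%N) :
  dominion (Var (AltG n.+1)) (alt_fix_last n) = [set: AltG n.+1]%classic /\
  epimorphism (Var (AltG n.+1)) (alt_embed n) /\
  ~ (forall y : AltG n.+1, exists x : AltG n, alt_embed n x = y).
Proof.
have dom : dominion (Var (AltG n.+1)) (alt_fix_last n) = [set: AltG n.+1]%classic.
  apply/seteqP; split=> // x _ C f g /Var_satisfies_laws lawC fg.
  apply: (simple_law_extension (alt_simple hn) (alt_nonabelian hn) lawC _ _ _ fg).
  - exact: gmulfM.
  - exact: gmulfM.
  - exact: alt_fix_last_nontrivial.
  - exact: alt_fix_last_rigid.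
split=> //; split.
  split=> [||C f g VC fg x].
  - apply: (variety_subgroup (Var_variety _) (@alt_embed_inj n)).
    exact: Var_self.
  - exact: Var_self.
  - have : dominion (Var (AltG n.+1)) (alt_fix_last n) x by rewrite dom.
    by apply=> // z; rewrite -range_alt_embed => -[y _ <-]; exact: fg.
move=> surj; have [y] := alt_moves_last hn; apply.
by rewrite -range_alt_embed; have [x <-] := surj y; exists x.
Qed.
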